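(* Every FLS space of finite scattered height has cardinality $\le\mathfrak d$. If $\mathfrak b>\omega_1$, then every FLS space of finite scattered height is countable.
   Context: For $f,g\in\omega^\omega$, $f\le^* g$ means $f(n)\le g(n)$ for all but finitely many $n$. $\mathfrak b$ is the least cardinality of a subset $B\subseteq\omega^\omega$ for which there is no $g\in\omega^\omega$ with $f\le^* g$ for all $f\in B$. $\mathfrak d$ is the least cardinality of a subset $D\subseteq\omega^\omega$ such that for every $f\in\omega^\omega$ there is $g\in D$ with $f\le^* g$. All spaces are Hausdorff topological spaces. For a space $X$, $X^{(1)}$ is the set of non-isolated points of $X$; $X^{(0)}=X$ and $X^{(\alpha)}=\bigcap_{\xi<\alpha}(X^{(\xi)})^{(1)}$ for ordinals $\alpha>0$. $X$ is scattered if every nonempty subspace has an isolated point; the scattered height of a scattered space $X$ is the smallest ordinal $\alpha$ with $X^{(\alpha)}=\emptyset$. An FLS space is a first-countable Lindelöf scattered (Hausdorff) space. Countable means of cardinality $\le\omega$. *)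

(* Defs.v *)
From HB Require Import structures.
From mathcomp Require Import all_boot all_order.
From mathcomp Require Import wochoice all_classical.
From mathcomp Require Import topology.

Set Implicit Arguments.
Unset Strict Implicit.
Unset Printing Implicit Defensive.

Local Open Scope classical_set_scope.
Local Open Scope card_scope.

(* A cardinal is represented by a set of that cardinality, so cardinals are
   compared with [#<=]. *)

Definition card_lt T U (A : set T) (B : set U) := (A #<= B) && ~~ (B #<= A).
Notation "A '#<' B" := (card_lt A B)
  (at level 79, format "A  '#<'  B") : card_scope.

Definition least_card T (P : set (set T)) (A : set T) :=
  P A /\ forall B, P B -> A #<= B.

(* By Zorn, take a maximal set F of functions choosing an element in every
   member of P, any two of which differ everywhere; F injects in every member
   of P and, by maximality, one of the evaluation maps is onto. *)
Lemma least_card_ex T (P : set (set T)) :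
  P !=set0 -> exists A, least_card P A.
Proof.
move=> [A0 PA0].
pose I := {A : set T | P A}.
pose S (F : set (I -> T)) := (forall x, F x -> forall i : I, sval i (x i)) /\
  (forall x y, F x -> F y -> forall i, x i = y i -> x = y).
have [|F [[Fin Finj] Fmax]] := @Zorn_bigcup _ S.
  move=> C CS Ctot; split=> [x [F CF Fx] i|x y [F CF Fx] [G CG Gy]].
    by have [+ _] := CS _ CF; exact.
  have [FG|GF] := Ctot _ _ CF CG.
    by have [_] := CS _ CG; apply => //; exact: FG.
  by have [_] := CS _ CF; apply => //; exact: GF.
have [[i iF]|nF] := pselect
    (exists i : I, sval i `<=` [set x i | x in F]).
  exists (sval i); split=> [|B PB]; first exact: (svalP i).
  apply: (@card_le_trans _ _ _ F).
    exact: card_le_trans (subset_card_le iF) (card_image_le _ _).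
  pose j : I := exist _ B PB.
  have /card_eqPle[_ Fj] : [set x j | x in F] #= F.
    by apply: inj_card_eq => x y /set_mem Fx /set_mem Fy; exact: Finj.
  apply: card_le_trans Fj _; apply: subset_card_le => _ [x Fx <-].
  exact: (Fin x Fx j).
have /choice[x xP] : forall i : I, exists t,
    sval i t /\ ~ [set x i | x in F] t.
  move=> i; apply: contrapT => nt; apply: nF; exists i => t it.
  by apply: contrapT => Ft; apply: nt; exists t.
have Fx : F x.
  suff -> : F = F `|` [set x] by right.
  apply: contrapT => FFx; apply: (Fmax (F `|` [set x])).
    by split; [exact: subsetUl|move=> h; apply: FFx; apply/seteqP; split].
  split=> [y [/Fin//|->] i|]; first by have [] := xP i.
  move=> y z [Fy|->] [Fz|->] i // yz; first exact: Finj yz.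
    by have [_] := xP i; case; exists y.
  by have [_] := xP i; case; exists z.
by have [_] := xP (exist _ A0 PA0); case; exists x.
Qed.

Definition le_star (f g : nat -> nat) := \forall n \near \oo, (f n <= g n)%N.

Definition unbounded_family (B : set (nat -> nat)) :=
  ~ exists g, forall f, B f -> le_star f g.

Definition dominating_family (D : set (nat -> nat)) :=
  forall f, exists2 g, D g & le_star f g.

Lemma unbounded_familyT : unbounded_family setT.
Proof.
move=> [g /(_ (fun n => (g n).+1) I)] [N _ /(_ N)] /=.
by rewrite leqnn ltnn => /(_ isT).
Qed.

Lemma dominating_familyT : dominating_family setT.
Proof. by move=> f; exists f => //; exists 0%N. Qed.

Definition frakb : set (nat -> nat) :=
  sval (cid (least_card_ex (ex_intro _ _ unbounded_familyT))).

Definition frakd : set (nat -> nat) :=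
  sval (cid (least_card_ex (ex_intro _ _ dominating_familyT))).

Lemma frakbP : least_card unbounded_family frakb.
Proof. exact: svalP (cid _). Qed.

Lemma frakdP : least_card dominating_family frakd.
Proof. exact: svalP (cid _). Qed.

(* In a well-order of an uncountable set, here Baire space, the elements with
   only countably many predecessors form an initial segment of order type
   omega_1: see [omega1_uncountable], [omega1_seg] and [omega1_down]. *)

Definition baire_le : rel (nat -> nat) :=
  sval (well_ordering_principle (nat -> nat)).

Lemma baire_le_wo : well_order baire_le.
Proof. exact: svalP (well_ordering_principle (nat -> nat)). Qed.

Definition omega1 : set (nat -> nat) :=
  [set x | countable [set y | baire_le y x]].

Lemma baire_le_total : total baire_le.
Proof.
have /wo_chainW h : wo_chain baire_le predT by move=> A _; exact: baire_le_wo.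
by move=> x y; exact: h.
Qed.

Lemma baire_le_anti : antisymmetric baire_le.
Proof.
have /wo_chain_antisymmetric h : wo_chain baire_le predT.
  by move=> A _; exact: baire_le_wo.
by move=> x y; exact: h.
Qed.

Lemma baire_le_min (A : set (nat -> nat)) : A !=set0 ->
  exists2 x, A x & forall y, A y -> baire_le x y.
Proof.
move=> [x0 Ax0]; have [|x [[/asboolP Ax xmin] _]] :=
    @baire_le_wo (fun x => `[< A x >]); first by exists x0; apply/asboolP.
by exists x => // y Ay; apply: xmin; apply/asboolP.
Qed.

Lemma baire_le_trans : transitive baire_le.
Proof.
move=> y x z xy yz.
have [|w /= wE wmin] := @baire_le_min [set w | [\/ w = x, w = y | w = z]].
  by exists x; constructor 1.
have [wx wy wz] : [/\ baire_le w x, baire_le w y & baire_le w z].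
  by split; apply: wmin; [constructor 1|constructor 2|constructor 3].
case: wE => E; rewrite E in wx wy wz => //.
- by have <- // : y = x by apply: baire_le_anti; rewrite wx xy.
- by have -> : z = y by apply: baire_le_anti; rewrite wy yz.
Qed.

Lemma baire_uncountable : ~ countable [set: nat -> nat].
Proof.
move=> /countable_injP[e e_inj].
have [g gP] : exists g : nat -> nat, forall f, g (e f) = (f (e f)).+1.
  have /choice[g gP] : forall n, exists m, forall f, e f = n -> m = (f n).+1.
    move=> n; have [[f fn]|nf] := pselect (exists f, e f = n).
      exists (f n).+1 => f' f'n; congr S.
      by rewrite (e_inj f f') ?inE// fn f'n.
    by exists 0%N => f fn; exfalso; apply: nf; exists f.
  by exists g => f; exact: gP.
by have /n_Sn := gP g.
Qed.

Lemma omega1_uncountable : ~ countable omega1.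
Proof.
move=> c1; have [|x /= nx xmin] := @baire_le_min (~` omega1).
  apply/set0P/eqP => /(congr1 setC); rewrite setCK setC0 => o1T.
  by apply: baire_uncountable; rewrite -o1T.
apply: nx; apply: (@sub_countable _ _ _ (omega1 `|` [set x])).
  apply: subset_card_le => y /= yx; have [|ny] := pselect (omega1 y); [by left|].
  by right; apply: baire_le_anti; rewrite yx xmin.
rewrite -bigcup2E; apply: bigcup_countable => // -[|[|n]] _ //=.
Qed.

Lemma omega1_seg x : omega1 x ->
  countable [set y | omega1 y /\ baire_le y x].
Proof. by apply: sub_countable; apply: subset_card_le => y []. Qed.

Lemma omega1_down x y : omega1 x -> baire_le y x -> omega1 y.
Proof.
move=> + yx; apply: sub_countable; apply: subset_card_le => z /= zy.
exact: baire_le_trans yx.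
Qed.

Definition first_countable (X : topologicalType) :=
  forall x : X, exists2 B : set (set X), countable B &
    B `<=` nbhs x /\ forall U, nbhs x U -> exists2 V, B V & V `<=` U.

Definition lindelof (X : topologicalType) :=
  forall C : set (set X), C `<=` open -> \bigcup_(U in C) U = setT ->
    exists2 D, D `<=` C & countable D /\ \bigcup_(U in D) U = setT.

(* [isolated A] is the set of isolated points of A with the subspace topology *)
Definition scattered (X : topologicalType) :=
  forall A : set X, A !=set0 -> isolated A !=set0.

Definition nonisolated (X : topologicalType) (A : set X) := A `\` isolated A.

(* the n-th Cantor-Bendixson derivative, n finite; [cb_derivative_bigcap]
   recovers the definition by transfinite intersection *)
Definition cb_derivative (X : topologicalType) (n : nat) : set X :=
  iter n (@nonisolated X) setT.
Arguments cb_derivative : clear implicits.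

Lemma cb_derivative_bigcap (X : topologicalType) n :
  cb_derivative X n = \bigcap_(k < n) nonisolated (cb_derivative X k).
Proof.
elim: n => [|n IH]; first by rewrite bigcap_mkord big_ord0.
pose F k := nonisolated (cb_derivative X k).
rewrite (bigcap_mkord n.+1 F) big_ord_recr -(bigcap_mkord n F) -IH /=.
by rewrite setIidr // => x [].
Qed.

Definition scattered_height (X : topologicalType) (n : nat) :=
  cb_derivative X n = set0 /\ forall m, cb_derivative X m = set0 -> (n <= m)%N.

Definition finite_scattered_height (X : topologicalType) :=
  exists n, scattered_height X n.

Definition FLS (X : topologicalType) :=
  [/\ hausdorff_space X, first_countable X, lindelof X & scattered X].

(* Main.v *)
Require Import Defs.
From mathcomp Require Import all_boot all_order all_classical topology.

(** Both assertions go by induction on the height, for closed subsets [A] of the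
    space. The last nonempty Cantor-Bendixson derivative [S] of [A] is closed
    and discrete, hence countable by the Lindelof property. Fix a decreasing
    countable base of open neighborhoods at each point of [S]. A function from
    the integers to the integers picks a basic neighborhood of each point of
    [S], and removing the union of these from [A] leaves a closed set of smaller
    height; a larger function removes less. A point [y] outside [S] is kept by
    the functions above some function [phi y], since singletons are closed, and
    a function dominating [phi y] modulo finite differs from one above it by
    taking the maximum with a constant ([cover_by_lower_height]).

    Let the function range over a dominating family of size [frakd], and the
    constant over the integers: [A] is the union of [S] and of [frakd] sets of
    smaller height, hence of size at most [frakd] by induction. The union has
    size at most [frakd] since [frakd] is infinite; this rests on the theorem
    that an infinite set [D] is as large as [D `*` D] ([card_setX_infinite]).

    If [omega1 #< frakb] and [A] is uncountable, take a subset of [A `\` S] that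
    is uncountable and of size at most [omega1]. The functions [phi y] attached
    to its points have a common bound [g], so countably many sets of smaller
    height, countable by induction, cover this subset: a contradiction. *)

Set Implicit Arguments.
Unset Strict Implicit.
Unset Printing Implicit Defensive.

Local Open Scope classical_set_scope.
Local Open Scope card_scope.

(** * Cardinals *)

Lemma card_le_fun T U (A : set T) (B : set U) (f : T -> U) :
  (forall x, A x -> B (f x)) ->
  (forall x y, A x -> A y -> f x = f y -> x = y) -> A #<= B.
Proof.
move=> fB fI; have /card_eqPle[_] : f @` A #= A.
  by apply: inj_card_eq => x y /set_mem Ax /set_mem Ay; exact: fI.
move=> /card_le_trans; apply; apply: subset_card_le => _ [x Ax <-]; exact: fB.
Qed.

Lemma card_le_ex T U (A : set T) (B : set U) (b0 : U) : A #<= B ->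
  exists f : T -> U, (forall x, A x -> B (f x)) /\
  (forall x y, A x -> A y -> f x = f y -> x = y).
Proof.
elim/Ppointed: U => U in B b0 *; first by case: (no b0).
move=> /pcard_leP[f]; exists f; split=> [x Ax|x y Ax Ay fxy].
  exact: (funS (s := f)).
by apply: (@inj _ _ _ f) => //; exact/mem_set.
Qed.

Lemma card_le_setX2 T U (A : set T) (B : set U) (b0 : U) :
  A #<= B -> A `*` A #<= B `*` B.
Proof.
move=> /(card_le_ex b0)[e [eB eI]].
apply: (@card_le_fun _ _ _ _ (fun p => (e p.1, e p.2))).
  by move=> [x y] [/= Ax Ay]; split; exact: eB.
by move=> [x y] [u v] [/= Ax Ay] [/= Au Av] [/eI -> // /eI -> //].
Qed.

(** Any two cardinals are comparable because a set of cardinals has a least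
    element: here the set made of the two cardinals, realised by disjoint
    copies in the sum type. *)
Lemma card_le_total T U (A : set T) (B : set U) : A #<= B \/ B #<= A.
Proof.
have inlI : (@inl T U) @` A #= A by apply: inj_card_eq => x y _ _ [].
have inrI : (@inr T U) @` B #= B by apply: inj_card_eq => x y _ _ [].
pose P (C : set (T + U)) := C = (@inl T U) @` A \/ C = (@inr T U) @` B.
have [|C [[]-> minC]] := @least_card_ex _ P; first by exists (@inl T U @` A); left.
- left; move: (minC _ (or_intror erefl)).
  by rewrite (card_le_eql inlI) (card_le_eqr inrI).
- right; move: (minC _ (or_introl erefl)).
  by rewrite (card_le_eqr inlI) (card_le_eql inrI).
Qed.

(** The graph of an injection of [K `*` K] into [K]. Being a graph over [T], it
    can be enlarged together with [K], and [K] can be read off its diagonal,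
    so Zorn's lemma for inclusion of sets applies. *)
Definition square_injection T (K : set T) (G : set ((T * T) * T)) :=
  [/\ forall a b c, G ((a, b), c) -> [/\ K a, K b & K c],
      forall a b, K a -> K b -> exists c, G ((a, b), c)
    & forall p q c, G (p, c) -> G (q, c) -> p = q].

Lemma square_injection_card_le T (K : set T) G : square_injection K G ->
  K `*` K #<= K.
Proof.
move=> [GK Gtot Ginj].
have /choice[f fP] : forall p : T * T, exists c, (K `*` K) p -> G (p, c).
  move=> [a b]; have [[Ka Kb]|nK] := pselect ((K `*` K) (a, b)); last first.
    by exists a.
  by have [c Gc] := Gtot a b Ka Kb; exists c.
apply: (@card_le_fun _ _ _ _ f) => [[x y] /fP /GK[]//|p q /fP Gp /fP Gq fpq].
by apply: Ginj Gp _; rewrite fpq.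
Qed.

(** Two copies of [K] fit in [K `*` K], as the fibres over two distinct points. *)
Lemma setU_square_card_le T (K L : set T) a b : K a -> K b -> a <> b ->
  K `*` K #<= K -> L #<= K -> K `|` L #<= K.
Proof.
move=> Ka Kb ab /(card_le_ex a)[p [pK pI]] /(card_le_ex a)[h [hK hI]].
pose e x := if `[< K x >] then p (a, x) else p (b, h x).
apply: (@card_le_fun _ _ _ _ e) => [x|x y] KL; rewrite /e.
  case: asboolP => [Kx|nKx]; first exact: pK.
  by case: KL => // Lx; apply: pK; split => //=; exact: hK.
case: asboolP => [Kx|nKx]; case: asboolP => [Ky|nKy] KL' /pI E.
- by have [] := E (conj Ka Kx) (conj Ka Ky).
- case: KL' => // Ly; have [] // := E (conj Ka Kx) (conj Kb (hK _ Ly)).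
- case: KL => // Lx; have [] // := E (conj Kb (hK _ Lx)) (conj Ka Ky).
  by move=> /esym.
- case: KL KL' => // Lx [//|Ly].
  have [] // := E (conj Kb (hK _ Lx)) (conj Kb (hK _ Ly)); exact: hI.
Qed.

(** The step of the Zorn argument. If [D] leaves room outside [K] for a copy [L]
    of [K], then the pairs of [K `|` L] that are not in [K `*` K] are at most
    as many as [K], hence can be sent injectively into [L], away from the
    values already taken in [K]. *)
Lemma square_injection_extend T (D K : set T) (G : set ((T * T) * T)) a b :
    K `<=` D -> K a -> K b -> a <> b -> square_injection K G ->
    K #<= D `\` K ->
  exists K' G', [/\ K' `<=` D, K `<=` K', square_injection K' G' & G `<` G'].
Proof.
move=> KD Ka Kb ab sG /(card_le_ex a)[h [hD hI]].
have [GK Gtot Ginj] := sG; have KK := square_injection_card_le sG.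
pose K' := K `|` h @` K.
have K'K : K' #<= K by apply: setU_square_card_le Ka Kb ab KK (card_image_le _ _).
have /(card_le_ex a)[e [eK eI]] : K' `*` K' #<= K.
  exact: card_le_trans (card_le_setX2 a K'K) KK.
pose N p := (K' `*` K') p /\ ~ (K `*` K) p.
exists K', (G `|` [set pc | N pc.1 /\ pc.2 = h (e pc.1)]).
split=> [x [/KD//|[y Ky <-]]|x Kx||].
- by have [] := hD _ Ky.
- by left.
- split=> [x y c [/GK[Kx Ky Kc]|[/= [[/= K'x K'y] _ ->]]]|x y K'x K'y|p q c].
  + by split; left.
  + by split=> //; right; exists (e (x, y)) => //; exact: eK.
  + have [[Kx Ky]|nK] := pselect ((K `*` K) (x, y)).
      by have [c Gc] := Gtot x y Kx Ky; exists c; left.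
    by exists (h (e (x, y))); right.
  + move=> [Gp|[/= [K'p _] cp]] [Gq|[/= [K'q _] cq]].
    * exact: Ginj Gp Gq.
    * case: p Gp => x y /GK[_ _ Kc].
      by have [_] := hD _ (eK _ K'q); rewrite -cq.
    * case: q Gq => x y /GK[_ _ Kc].
      by have [_] := hD _ (eK _ K'p); rewrite -cp.
    * by apply: eI => //; apply: hI; rewrite -?cp//; exact: eK.
- split; first by left.
have hK : K' (h a) by right; exists a.
have [_ nKh] := hD _ Ka.
suff nG : ~ G ((h a, h a), h (e (h a, h a))).
  by move=> sub; apply/nG/sub; right; split=> //; split=> // -[].
by move=> /GK[].
Qed.

(** Hessenberg's theorem. Among the subsets [K] of [D] that contain two fixed
    points and carry an injection of [K `*` K] into [K], take one whose
    injection has no extension: by the previous lemma [D `\` K] is no larger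
    than [K], so that [D] itself injects into [K]. *)
Lemma card_setX_infinite T (D : set T) : infinite_set D -> D `*` D #<= D.
Proof.
move=> Dinf; have [d0 _] := infinite_setN0 Dinf.
have /infiniteP/(card_le_ex d0)[i [iD iI]] := Dinf.
have iI' m n : i m = i n -> m = n by exact: iI.
have ab : i 0%N <> i 1%N by move=> /iI'.
(* The empty graph is admitted for the sake of the empty chain; the others have
   two distinct points in their base, as needed to extend them. *)
pose P (G : set ((T * T) * T)) := G = set0 \/
  exists K, [/\ K `<=` D, K (i 0%N), K (i 1%N) & square_injection K G].
pose G0 := [set ((i mn.1, i mn.2), i (pickle mn)) | mn in [set: nat * nat]].
have PG0 : P G0.
  right; exists (range i); split=> [_ [n _ <-]||  |].
  - exact: iD.
  - by exists 0%N.
  - by exists 1%N.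
  split=> [a b c [[m n] _ [<- <- <-]]|_ _ [m _ <-] [n _ <-]|].
  - by split; eexists.
  - by exists (i (pickle (m, n))); exists (m, n).
  move=> p q c [mn _ [<- <-]] [mn' _ [<- /iI']].
  by move=> /(pcan_inj (@pickleK _)) ->.
have [C CP Ctot|G [PG Gmax]] := @Zorn_bigcup _ P.
  have [nC|] := pselect (forall G, C G -> G = set0).
    left; apply/seteqP; split=> // x [G CG Gx].
    by rewrite (nC _ CG) in Gx.
  move=> /existsNP[G1 /not_implyP[CG1 G1n]].
  pose K := [set x | exists2 G, C G & exists c, G ((x, x), c)].
  have KE G KG : C G -> square_injection KG G -> KG `<=` K.
    move=> CG [_ Gtot _] x Kx; exists G => //; exact: Gtot.
  have common p q : (\bigcup_(G in C) G) p -> (\bigcup_(G in C) G) q ->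
      exists G KG, [/\ C G, square_injection KG G, G p & G q].
    move=> [Gp CGp Gpp] [Gq CGq Gqq].
    have [G [CG Gp' Gq']] : exists G, [/\ C G, G p & G q].
      by have [pq|qp] := Ctot _ _ CGp CGq; [exists Gq|exists Gp];
        split=> //; [exact: pq|exact: qp].
    have [G00|[KG [_ _ _ sG]]] := CP _ CG; first by rewrite G00 in Gp'.
    by exists G, KG.
  right; exists K; have [//|[K1 [K1D K10 K11 sK1]]] := CP _ CG1.
  split=> [x [G CG [c Gc]]|||].
  - have [G00|[KG [KGD _ _ [GK _ _]]]] := CP _ CG; first by rewrite G00 in Gc.
    by have [/KGD] := GK _ _ _ Gc.
  - exact: KE sK1 _ _.
  - exact: KE sK1 _ _.
  split=> [a b c Gc|a b [Ga CGa [ca Gac]] [Gb CGb [cb Gbc]]|p q c Gp Gq].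
  - have [G [KG [CG sG Gc' _]]] := common _ _ Gc Gc.
    have [GK _ _] := sG; have [Ka Kb Kc] := GK _ _ _ Gc'.
    by split; exact: KE sG _ _.
  - have [||G [KG [CG [GK Gtot _] Ga' Gb']]] :=
      common ((a, a), ca) ((b, b), cb); [by exists Ga|by exists Gb|].
    have [Ka _ _] := GK _ _ _ Ga'; have [Kb _ _] := GK _ _ _ Gb'.
    by have [c Gc] := Gtot a b Ka Kb; exists c; exists G.
  - have [G [KG [_ [_ _ Ginj] Gp' Gq']]] := common _ _ Gp Gq.
    exact: Ginj Gp' Gq'.
have [G00|[K [KD K0 K1 sG]]] := PG.
  exfalso; apply: (Gmax G0) PG0; rewrite G00; split=> // sub.
  by apply: (sub ((i 0%N, i 0%N), i (pickle (0%N, 0%N)))); exists (0%N, 0%N).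
have [KDK|DKK] := card_le_total K (D `\` K).
  have [K' [G' [K'D KK' sG' GG']]] := square_injection_extend KD K0 K1 ab sG KDK.
  exfalso; apply: Gmax GG' _; right; exists K'; split=> //; exact: KK'.
have KK := square_injection_card_le sG.
have DK : D #<= K.
  by rewrite -(setDUK KD); exact: setU_square_card_le K0 K1 ab KK DKK.
apply: card_le_trans (subset_card_le KD); apply: card_le_trans KK.
exact: card_le_setX2 d0 DK.
Qed.

(** A point [x] of the union is coded by the code of an index [i] with
    [F i x] and the code of [x] in [F i]; pairs of codes are no more than
    codes. *)
Lemma card_le_bigcup I T U (A : set I) (F : I -> set T) (D : set U) :
    infinite_set D -> A #<= D -> (forall i, A i -> F i #<= D) ->
  \bigcup_(i in A) F i #<= D.
Proof.
move=> Dinf AD FD; have [d0 Dd0] := infinite_setN0 Dinf.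
apply: card_le_trans (card_setX_infinite Dinf).
have [f [fD fI]] := card_le_ex d0 AD.
have /choice[g gP] : forall i, exists g : T -> U, A i ->
    (forall x, F i x -> D (g x)) /\
    (forall x y, F i x -> F i y -> g x = g y -> x = y).
  move=> i; have [Ai|nA] := pselect (A i); last by exists (fun=> d0).
  by have [g gP] := card_le_ex d0 (FD i Ai); exists g.
have /choice[h hP] : forall x : T, exists i : option I,
    (\bigcup_(i in A) F i) x -> exists2 j, i = Some j & A j /\ F j x.
  move=> x; have [[i Ai Fx]|nx] := pselect ((\bigcup_(i in A) F i) x).
    by exists (Some i) => _; exists i.
  by exists None.
pose e x := if h x is Some i then (f i, g i x) else (d0, d0).
apply: (@card_le_fun _ _ _ _ e); rewrite /e.
  move=> x /hP[i -> [Ai Fx]]; split; first exact: fD.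
  by have [+ _] := gP i Ai; exact.
move=> x y /hP[i -> [Ai Fx]] /hP[j -> [Aj Fy]] [/fI ij].
rewrite -(ij Ai Aj) in Fy *.
by have [_] := gP i Ai; exact.
Qed.

Lemma card_le_setU T U (A B : set T) (D : set U) : infinite_set D ->
  A #<= D -> B #<= D -> A `|` B #<= D.
Proof.
move=> Dinf AD BD; rewrite -bigcup2E; apply: card_le_bigcup => //.
  exact/infiniteP.
by move=> [|[|n]] _ //=; exact: card_ge0.
Qed.

(** A finite family is dominated everywhere by the sum of its members, and the
    successor of that sum escapes it. *)
Lemma infinite_frakd : infinite_set frakd.
Proof.
move=> /finite_seqP[s sE]; have [dom _] := frakdP.
have [g] := dom (fun n => (\sum_(f <- s) f n).+1).
rewrite sE /= => gs [N _ /(_ N (leqnn N))] /=.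
by rewrite (big_rem g) //= ltnNge leq_addr.
Qed.

(** * Derivatives of closed sets *)

Section Derivatives.
Context {X : topologicalType}.
Implicit Types A B : set X.

Lemma nonisolatedS A B : A `<=` B -> nonisolated A `<=` nonisolated B.
Proof.
move=> AB x [Ax nAx]; split; first exact: AB.
move=> [_ [V Vx VB]]; apply: nAx; split; first exact: mem_set.
exists V => //; apply/seteqP; split=> [y [Vy /AB By]|_ ->].
  by rewrite -VB.
by split=> //; exact: nbhs_singleton.
Qed.

Lemma closed_nonisolated A : closed A -> closed (nonisolated A).
Proof.
move=> cA x clx; split.
  by apply: cA => V /clx[y [[Ay _] Vy]]; exists y.
move=> [_ [V Vx VA]]; have [y [[Ay nAy] Vy]] := clx V Vx.
have yx : y = x by have : [set x] y by rewrite -VA.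
by apply: nAy; split; [exact: mem_set|exists V; rewrite yx].
Qed.

Lemma iter_nonisolatedS n A B : A `<=` B ->
  iter n (@nonisolated X) A `<=` iter n (@nonisolated X) B.
Proof. by move=> AB; elim: n => //= n; exact: nonisolatedS. Qed.

Lemma iter_nonisolated_sub n A : iter n (@nonisolated X) A `<=` A.
Proof. by elim: n => //= n IH x [/IH]. Qed.

Lemma closed_iter_nonisolated n A : closed A ->
  closed (iter n (@nonisolated X) A).
Proof. by move=> cA; elim: n => //= n; exact: closed_nonisolated. Qed.

Lemma lindelof_closed A (C : set (set X)) : lindelof X -> closed A ->
    C `<=` open -> A `<=` \bigcup_(U in C) U ->
  exists2 D, D `<=` C & countable D /\ A `<=` \bigcup_(U in D) U.
Proof.
move=> LX cA Co AC.
have [||D DC [cD DX]] := LX (C `|` [set ~` A]).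
- by move=> U [/Co//|->]; exact: closed_openC.
- apply/seteqP; split=> // x _; have [/AC[U CU Ux]|nAx] := pselect (A x).
    by exists U => //; left.
  by exists (~` A) => //; right.
exists (D `&` C); first by move=> U [].
split; first by apply: sub_countable cD; apply: subset_card_le => U [].
move=> x Ax; have [U DU Ux] : (\bigcup_(U in D) U) x by rewrite DX.
exists U => //; split=> //; have [//|UA] := DC _ DU.
by rewrite UA in Ux.
Qed.

Lemma lindelof_discrete_countable A : lindelof X -> closed A ->
  nonisolated A = set0 -> countable A.
Proof.
move=> LX cA A0.
pose C := [set U : set X | open U /\ exists x, U `&` A = [set x]].
have [|x Ax|D DC [cD AD]] := lindelof_closed LX cA (C := C).
- by move=> U [].
- have [_ [V Vx VA]] : isolated A x.
    by apply: contrapT => nx; have : nonisolated A x by []; rewrite A0.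
  exists (interior V) => //; split; first exact: open_interior.
  exists x; apply/seteqP; split=> [y [/interior_subset Vy Ay]|_ ->].
    by rewrite -VA.
  by split.
apply: (@sub_countable _ _ _ (\bigcup_(U in D) (U `&` A))).
  by apply: subset_card_le => x Ax; have [U DU Ux] := AD _ Ax; exists U.
by apply: bigcup_countable => // U /DC[_ [x ->]]; exact: countable1.
Qed.

(** At each point the members of a countable local base are intersected
    successively, so that raising the index only shrinks the neighborhood. *)
Lemma separating_neighborhoods : hausdorff_space X -> first_countable X ->
  exists U : X -> nat -> set X,
    [/\ forall x m, open (U x m), forall x m, U x m x,
        forall x m k, (m <= k)%N -> U x k `<=` U x m
      & forall x y, y <> x -> exists m, ~ U x m y].
Proof.
move=> hX fX.
suff /choice[U UP] : forall x : X, exists V : nat -> set X,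
    [/\ forall m, open (V m), forall m, V m x,
        forall m k, (m <= k)%N -> V k `<=` V m
      & forall y, y <> x -> exists m, ~ V m y].
  exists U; split=> x.
  - by have [] := UP x.
  - by have [] := UP x.
  - by have [] := UP x.
  - by have [_ _ _] := UP x; exact.
(* The [i]-th factor is the interior of the member of the base coded by [i], or
   the whole space if there is none. *)
move=> x; have [B cB [Bx Bbase]] := fX x.
have /countable_injP[c cI] := cB.
have /choice[e eP] : forall i, exists W : set X,
    [/\ open W, W x & forall W', B W' -> c W' = i -> W `<=` W'].
  move=> i; have [[W [BW cW]]|nB] := pselect (exists W, B W /\ c W = i).
    exists (interior W); split; [exact: open_interior|exact: Bx|].
    move=> W' BW' cW'; suff -> : W' = W by exact: interior_subset.
    by apply: cI; rewrite ?inE// cW'.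
  exists setT; split=> //; first exact: openT.
  by move=> W BW cW; exfalso; apply: nB; exists W.
exists (fun m => \bigcap_(i < m) e i); split=> [m|m i _|m k mk y Vy i im|y yx].
- by rewrite bigcap_mkord; elim/big_ind: _ => [||i _];
    [exact: openT|exact: openI|have [] := eP i].
- by have [] := eP i.
- by apply: Vy; exact: leq_trans im mk.
- have [W [oW /set_mem Wx /set_mem Wy]] : exists W, [/\ open W, x \in W & y \in ~` W].
    by apply: (hausdorff_accessible hX); apply/eqP => /esym.
  have [W' BW' W'W] := Bbase W (open_nbhs_nbhs (conj oW Wx)).
  exists (c W').+1 => /(_ (c W') (ltnSn _)).
  by have [_ _ /(_ W' BW' erefl) eW'] := eP (c W'); move=> /eW'/W'W.
Qed.

(** * Covering by sets of smaller height *)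

(** The heart of the proof. The last nonempty derivative [S] is discrete and
    closed, hence countable; let [c] number its points. A function [g] and an
    integer [m] define the neighborhood of [S] that is the union of the basic
    neighborhoods of index [maxn (g (c t)) m] of the points [t] of [S]; its
    complement [Y g m] in [A] loses the last derivative. A point [y] outside
    [S] is missed by the neighborhoods of index [phi y (c t)], and if [g]
    dominates [phi y] up to finitely many exceptions, then a large [m] makes
    up for these exceptions. *)
Lemma cover_by_lower_height n A :
    hausdorff_space X -> first_countable X -> lindelof X ->
    closed A -> iter n.+1 (@nonisolated X) A = set0 ->
  exists (S : set X) (Y : (nat -> nat) -> nat -> set X) (phi : X -> nat -> nat),
  [/\ countable S,
      forall g m, closed (Y g m),
      forall g m, iter n (@nonisolated X) (Y g m) = set0
    & forall y g, A y -> ~ S y -> le_star (phi y) g -> exists m, Y g m y].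
Proof.
move=> hX fX LX cA A0; set S := iter n (@nonisolated X) A.
have cS : countable S.
  by apply: lindelof_discrete_countable A0 => //; exact: closed_iter_nonisolated.
have /countable_injP[c cI] := cS.
have [U [Uo Ux Umono Usep]] := separating_neighborhoods hX fX.
pose V g m := \bigcup_(t in S) U t (maxn (g (c t)) m).
have /choice[phi phiP] : forall y, exists f : nat -> nat,
    ~ S y -> forall t, S t -> ~ U t (f (c t)) y.
  move=> y; have [Sy|nSy] := pselect (S y); first by exists (fun=> 0%N).
  have /choice[f fP] : forall k, exists j, forall t, S t -> c t = k -> ~ U t j y.
    move=> k; have [[t [St ct]]|nt] := pselect (exists t, S t /\ c t = k).
      have [|j nj] := @Usep t y; first by move=> yt; rewrite yt in nSy.
      exists j => t' St' ct'; suff -> : t' = t by [].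
      by apply: cI; rewrite ?inE// ct'.
    by exists 0%N => t St ct; exfalso; apply: nt; exists t.
  by exists f => _ t St; exact: fP.
exists S, (fun g m => A `\` V g m), phi; split=> //.
- move=> g m; rewrite setDE; apply: closedI => //; apply: open_closedC.
  by apply: bigcup_open => t _; exact: Uo.
- move=> g m; apply/seteqP; split=> // x itx.
  have [_] := iter_nonisolated_sub itx; apply; exists x; last exact: Ux.
  by apply: iter_nonisolatedS itx => y [].
- move=> y g Ay nSy [N _ gN].
  (* This [m] bounds [phi y] below [N], where [g] may fail to do so. *)
  exists (\sum_(i < N) phi y i)%N; split=> // -[t St Uty].
  apply: (phiP y nSy t St); apply: Umono Uty.
  have [Nc|cN] := leqP N (c t).
    by rewrite (leq_trans (gN _ Nc))// leq_maxl.
  rewrite (leq_trans _ (leq_maxr _ _))//.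
  by rewrite (bigD1 (Ordinal cN)) //= leq_addr.
Qed.

(** When [g] ranges over a dominating family, the sets [Y g m] cover [A `\` S]. *)
Lemma card_le_frakd n A :
    hausdorff_space X -> first_countable X -> lindelof X ->
    closed A -> iter n (@nonisolated X) A = set0 -> A #<= frakd.
Proof.
move=> hX fX LX; elim: n A => [|n IH] A cA A0; first by rewrite [A]A0 card_ge0.
have [S [Y [phi [cS cY Y0 YA]]]] := cover_by_lower_height hX fX LX cA A0.
have natd : [set: nat] #<= frakd by apply/infiniteP; exact: infinite_frakd.
apply: (@card_le_trans _ _ _
    (S `|` \bigcup_(g in frakd) \bigcup_(m in [set: nat]) Y g m)).
  apply: subset_card_le => y Ay; have [Sy|nSy] := pselect (S y); first by left.
  have [dom _] := frakdP; have [g gd pg] := dom (phi y).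
  by have [m Ym] := YA y g Ay nSy pg; right; exists g => //; exists m.
apply: card_le_setU; [exact: infinite_frakd|exact: card_le_trans cS natd|].
apply: card_le_bigcup => // [|g _]; first exact: infinite_frakd.
by apply: card_le_bigcup => // [|m _]; [exact: infinite_frakd|exact: IH].
Qed.

(** An uncountable [A `\` S] would contain an uncountable [Z] of size at most
    [omega1], by comparability. The functions [phi y], [y] in [Z], are fewer
    than [frakb], so that one [g] bounds them all and [Z] is covered by the
    countably many sets [Y g m], which are countable by induction. *)
Lemma countable_of_frakb n A : omega1 #< frakb ->
    hausdorff_space X -> first_countable X -> lindelof X ->
    closed A -> iter n (@nonisolated X) A = set0 -> countable A.
Proof.
move=> /andP[_ nb] hX fX LX; elim: n A => [|n IH] A cA A0.
  by rewrite [A]A0; exact: countable0.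
have [S [Y [phi [cS cY Y0 YA]]]] := cover_by_lower_height hX fX LX cA A0.
suff cAS : countable (A `\` S).
  apply: (@sub_countable _ _ _ (S `|` A `\` S)).
    by apply: subset_card_le => x Ax; have [|] := pselect (S x); [left|right].
  rewrite -bigcup2E; apply: bigcup_countable => // -[|[|k]] _ //=.
apply: contrapT => nc.
have [Z [ZA nZ Zo1]] : exists Z, [/\ Z `<=` A `\` S, ~ countable Z & Z #<= omega1].
  have [le|le] := card_le_total (A `\` S) omega1; first by exists (A `\` S); split.
  have [x0 _] : A `\` S !=set0.
    by apply/set0P/eqP => AS0; apply: nc; rewrite AS0; exact: countable0.
  have [h [hA hI]] := card_le_ex x0 le.
  exists (h @` omega1); split; [by move=> _ [x ox <-]; exact: hA| |exact: card_image_le].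
  move=> c; apply: omega1_uncountable; apply: sub_countable c.
  have /card_eqPle[_] // : h @` omega1 #= omega1.
  by apply: inj_card_eq => x y /set_mem ox /set_mem oy; exact: hI.
have [g gP] : exists g, forall f, (phi @` Z) f -> le_star f g.
  apply: contrapT => unb; move/negP: nb; apply.
  have [_ /(_ _ unb) le] := frakbP.
  exact: card_le_trans le (card_le_trans (card_image_le _ _) Zo1).
apply: nZ; apply: (@sub_countable _ _ _ (\bigcup_(m in [set: nat]) Y g m)).
  apply: subset_card_le => y Zy; have [Ay nSy] := ZA _ Zy.
  by have [|m Ym] := YA y g Ay nSy; [apply: gP; exists y|exists m].
by apply: bigcup_countable => // m _; exact: IH.
Qed.

End Derivatives.

Theorem corollary5p7 :
  (forall X : topologicalType, FLS X -> finite_scattered_height X ->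
     [set: X] #<= frakd) /\
  (omega1 #< frakb ->
   forall X : topologicalType, FLS X -> finite_scattered_height X ->
     countable [set: X]).
Proof.
split=> [|b] X [hX fX LX _] [n [X0 _]].
  exact: card_le_frakd closedT X0.
exact: countable_of_frakb closedT X0.
Qed.
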